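(* Let $G_1, G_2, G_3$ be three directed graphs on a common set of $n$ vertices. If for every $1 \leq i < j \leq 3$ it holds that $e(G_i)+e(G_j)>\left(\frac{104-8\sqrt{7}}{81}\right)n^2+3n$, then there exists a rainbow transitive triangle.
   Context: A directed graph $G$ consists of a vertex set $V(G)$ and an edge set $E(G)$ of ordered pairs of distinct vertices (no loops, no multiple edges; both $(u,v)$ and $(v,u)$ may be present). $e(G)=|E(G)|$. The edges of $G_i$ are thought of as having color $i$. A rainbow transitive triangle is a triple of distinct vertices $u,v,w$ together with pairwise distinct colors $a,b,d\in\{1,2,3\}$ such that $(u,v)\in E(G_a)$, $(v,w)\in E(G_b)$, $(u,w)\in E(G_d)$. *)

(* Defs.v *)
From mathcomp Require Import all_boot all_order all_algebra.

Set Implicit Arguments.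
Unset Strict Implicit.
Unset Printing Implicit Defensive.

Record digraph (T : finType) := Digraph {
  edges : {set T * T};
  edges_loopless : forall v : T, (v, v) \notin edges
}.

(* Only the three vertices and the three colours are required to be distinct:
   different graphs of the family may share edges, so an edge may carry
   several colours. *)
Definition rainbow_transitive_triangle (T : finType) (G : 'I_3 -> digraph T)
    : Prop :=
  exists (u v w : T) (a b d : 'I_3),
    [/\ [/\ u != v, v != w & u != w],
        [/\ a != b, b != d & a != d]
      & [/\ (u, v) \in edges (G a),
            (v, w) \in edges (G b)
          & (u, w) \in edges (G d)]].

(* Main.v *)
Require Import Defs.
From mathcomp Require Import all_boot all_order all_algebra.
From mathcomp Require Import boolp classical_sets reals topology normedtype derive.
From mathcomp Require Import Rstruct.
From mathcomp Require Import ring lra.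
Import Order.TTheory GRing.Theory Num.Theory.
Import numFieldNormedType.Exports.
Set Implicit Arguments.
Unset Strict Implicit.
Unset Printing Implicit Defensive.
Local Open Scope ring_scope.

(** Replace every vertex by [n + 2] clones and join the clones [u_i] and [v_j],
    [i < j], in the colours of the edge [(u, v)]: since indices order the vertices
    of a triangle, an undirected rainbow triangle of clones comes from a rainbow
    transitive triangle. The term [3 n] pays for the lost pairs of clones with
    equal index. It remains to bound undirected vertex-weighted templates, where
    the pairwise densities cannot all exceed [1 + tau^2], [tau = (4 - sqrt 7) / 9]
    being a root of [9 tau^2 - 8 tau + 1].

    Take weights maximizing the product of the three excesses over this bound.
    First-order optimality gives positive multipliers, one for each pair of
    colours, such that every vertex of the support has positive total excess.
    This forbids triple edges, alternating 4-cycles of double edges, and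
    bichromatic cherries of double edges for at least one pair of double
    colours. The ends of every remaining cherry are non-adjacent. Splitting each
    vertex among the three double colours in proportion to the square roots of
    its degrees, AM-GM shows that the double edges of a colour, minus the
    non-adjacent pairs charged to it, have density at most the square [r^2] of
    the total share [r] of that colour. The three shares sum to at most 1 and
    exceed [tau], so the sum of their squares is at most
    [(1 - 2 tau)^2 + 2 tau^2 = (1 + 3 tau^2) / 2], which the total density
    exceeds. *)

(** * Enumerating the three colours *)

Lemma ord3_cover (c i j e : 'I_3) : uniq [:: i; j; e] -> c \in [:: i; j; e].
Proof.
move=> uniq_ije; have sub : {subset [:: i; j; e] <= enum 'I_3}.
  by move=> k _; rewrite mem_enum.
have [|_ ->] := uniq_min_size uniq_ije sub; first by rewrite size_enum_ord.
by rewrite mem_enum.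
Qed.

Lemma ord3_third (i j : 'I_3) : i != j -> exists e, uniq [:: i; j; e].
Proof.
move=> ij; have /subsetPn[e _] : ~~ ([set: 'I_3] \subset [set i; j]).
  by apply/negP => /subset_leq_card; rewrite cardsT card_ord cards2 ij.
rewrite !inE negb_or => /andP[ei ej]; exists e.
by rewrite /= !inE negb_or ij (eq_sym i) ei (eq_sym j) ej.
Qed.

Lemma ord3_others (i : 'I_3) : exists j e, uniq [:: i; j; e].
Proof.
have [j ij] : exists j, i != j.
  by case: (eqVneq i ord0) => [->|]; [exists ord_max|exists ord0].
by have [e] := ord3_third ij; exists j, e.
Qed.

Lemma uniq3_swap (i j e : 'I_3) : uniq [:: i; j; e] -> uniq [:: j; i; e].
Proof.
rewrite /= !inE !negb_or !andbT => /andP[/andP[ij ie] je].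
by rewrite (eq_sym j) ij je ie.
Qed.

Lemma uniq3_rot (i j e : 'I_3) : uniq [:: i; j; e] -> uniq [:: j; e; i].
Proof. by move=> u; rewrite -(rot_uniq 2). Qed.

Lemma perm_ord3 (i j e : 'I_3) : uniq [:: i; j; e] ->
  perm_eq (index_enum 'I_3) [:: i; j; e].
Proof.
move=> u; apply: uniq_perm; [exact: index_enum_uniq|exact: u|move=> k].
by rewrite mem_index_enum ord3_cover.
Qed.

Lemma sum_ord3 (R : nmodType) (i j e : 'I_3) (F : 'I_3 -> R) :
  uniq [:: i; j; e] -> \sum_k F k = F i + F j + F e.
Proof.
move=> ije; rewrite (perm_big _ (perm_ord3 ije)) /=.
by rewrite !big_cons big_nil addr0 addrA.
Qed.

Lemma prod_ord3 (R : comPzRingType) (i j e : 'I_3) (F : 'I_3 -> R) :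
  uniq [:: i; j; e] -> \prod_k F k = F i * F j * F e.
Proof.
move=> ije; rewrite (perm_big _ (perm_ord3 ije)) /=.
by rewrite !big_cons big_nil mulr1 mulrA.
Qed.

(** * Templates: double edges, non-adjacent pairs and cherries *)

Section Template.
Variables (R : rcfType) (V : finType) (x : 'I_3 -> rel V).

Definition rainbow_free := forall a b d : 'I_3, uniq [:: a; b; d] ->
  forall u v w : V, ~~ [&& x a u v, x b v w & x d u w].

(* A pair of colours is named by the third colour [c]: a double edge of colour
   [c] carries both colours other than [c]. *)
Definition excess (c : 'I_3) (u v : V) : R :=
  \sum_(i | i != c) (x i u v)%:R - 1.
Definition double (c : 'I_3) (u v : V) := [forall i, (i != c) ==> x i u v].
Definition empty (u v : V) := [forall i, ~~ x i u v].

Hypothesis x_sym : forall c, symmetric (x c).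
Hypothesis x_free : rainbow_free.

Lemma free6 (i j e : 'I_3) u v w : uniq [:: i; j; e] ->
  [/\ ~~ [&& x i u v, x j v w & x e u w], ~~ [&& x i u v, x e v w & x j u w]
   & [/\ ~~ [&& x j u v, x i v w & x e u w], ~~ [&& x j u v, x e v w & x i u w],
       ~~ [&& x e u v, x i v w & x j u w] & ~~ [&& x e u v, x j v w & x i u w]]].
Proof.
move=> ije; have jei := uniq3_rot ije; have eij := uniq3_rot jei.
have jie := uniq3_swap ije; have iej := uniq3_rot jie.
by split; [| |split]; apply: x_free; rewrite // uniq3_rot.
Qed.

Lemma excessE (c i j : 'I_3) u v : uniq [:: c; i; j] ->
  excess c u v = (x i u v)%:R + (x j u v)%:R - 1.
Proof.
move=> cij; congr (_ - 1).
have := sum_ord3 (fun i => (x i u v)%:R : R) cij.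
by rewrite (bigD1 c) //= -addrA => /addrI.
Qed.

Lemma doubleE (c i j : 'I_3) u v : uniq [:: c; i; j] ->
  double c u v = x i u v && x j u v.
Proof.
move=> cij; have := cij; rewrite /= !inE negb_or => /and3P[/andP[ci cj] _ _].
apply/forallP/andP => [dbl|[xi xj] k].
  by split; [have := dbl i; rewrite eq_sym ci|have := dbl j; rewrite eq_sym cj].
apply/implyP => kc; have := ord3_cover k cij.
by rewrite !inE (negPf kc) /= => /orP[] /eqP->.
Qed.

Lemma emptyE (c i j : 'I_3) u v : uniq [:: c; i; j] ->
  empty u v = [&& ~~ x c u v, ~~ x i u v & ~~ x j u v].
Proof.
move=> cij; apply/forallP/and3P => [emp|[xc xi xj] k]; first by split.
by have := ord3_cover k cij; rewrite !inE => /or3P[] /eqP->.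
Qed.

Lemma excess_sym c u v : excess c u v = excess c v u.
Proof. by congr (_ - 1); apply: eq_bigr => i _; rewrite x_sym. Qed.
Lemma double_sym c u v : double c u v = double c v u.
Proof. by apply: eq_forallb => i; rewrite x_sym. Qed.

Lemma double_not_empty c u v : double c u v -> ~~ empty u v.
Proof.
have [i [j cij]] := ord3_others c.
by rewrite (doubleE _ _ cij) (emptyE _ _ cij) => /andP[-> _]; rewrite andbF.
Qed.

(** Both edges carry the third colour, [u v] also carries [c'] and [v w] also carries [c]. Whatever
    colour [u w] had, the path could use the two remaining ones. *)
Lemma cherry_empty (c c' : 'I_3) u v w : c != c' ->
  double c u v -> double c' v w -> empty u w.
Proof.
move=> /ord3_third[e u1]; have u2 := uniq3_swap u1.
rewrite (doubleE _ _ u1) (doubleE _ _ u2) (emptyE _ _ u1).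
move=> /andP[c'uv euv] /andP[cvw evw].
have [_ _ [f1 f2 f3 _]] := free6 u v w u1.
by move: f1 f2 f3; rewrite c'uv euv cvw evw /= => -> -> ->.
Qed.

(** * Configurations excluded by first-order optimality *)

Section Weights.
Variables (mu : V -> R) (lam : 'I_3 -> R).
Hypotheses (mu_gt0 : forall v, 0 < mu v) (lam_gt0 : forall c, 0 < lam c).

Definition potential (v w : V) : R := \sum_c lam c * excess c v w.

Hypothesis stationary : forall v, 0 < \sum_w mu w * potential v w.

Lemma potentialE (c i j : 'I_3) u v : uniq [:: c; i; j] ->
  potential u v = lam c * ((x i u v)%:R + (x j u v)%:R - 1)
    + lam i * ((x c u v)%:R + (x j u v)%:R - 1)
    + lam j * ((x c u v)%:R + (x i u v)%:R - 1).
Proof.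
move=> u1; have u2 := uniq3_swap u1; have u3 := uniq3_rot (uniq3_rot u1).
by rewrite /potential (sum_ord3 _ u1) (excessE _ _ u1) (excessE _ _ u2) (excessE _ _ u3).
Qed.

(** Averaging over [z] with the weights [mu] turns the pointwise bound into a contradiction with
    [stationary]. *)
Lemma combination3 (a b d : R) (u v w : V) : 0 <= a -> 0 < b -> 0 <= d ->
  (forall z, a * potential u z + b * potential v z + d * potential w z <= 0) ->
  False.
Proof.
move=> a0 b0 d0 le0.
have := stationary u; have := stationary v; have := stationary w.
set pw := \sum_z _ => pw0; set pv := \sum_z _ => pv0; set pu := \sum_z _ => pu0.
have : 0 < a * pu + b * pv + d * pw.
  by rewrite addrAC ltr_wpDl ?mulr_gt0 // addr_ge0 // mulr_ge0 // ltW.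
rewrite /pu /pv /pw !mulr_sumr -!big_split /= ltNge => /negP; apply.
apply: sumr_le0 => z _.
rewrite (_ : _ + _ = mu z * (a * potential u z + b * potential v z
  + d * potential w z)); last by ring.
by rewrite pmulr_rle0.
Qed.

(** Different colours on [u z] and [v z] would complete a rainbow triangle. So either one of these
    pairs is empty, which costs the sum of all multipliers, the most the other can gain, or both
    carry the same single colour and have negative potential. *)
Lemma no_triple c u v : double c u v -> ~~ x c u v.
Proof.
have [i [j cij]] := ord3_others c.
rewrite (doubleE u v cij) => /andP[xi xj]; apply/negP => xc.
apply: (@combination3 1 1 0 u v u) => // z.
rewrite !(potentialE _ _ cij) mul0r addr0 !mul1r.
have l0 := lam_gt0 c; have l1 := lam_gt0 i; have l2 := lam_gt0 j.
have [] := free6 u v z cij; rewrite xc xi xj /=.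
case: (x c u z); case: (x i u z); case: (x j u z);
case: (x c v z); case: (x i v z); case: (x j v z); by move=> //= _ _ []; lra.
Qed.

Lemma double_other_color (c c' : 'I_3) u v : c != c' ->
  double c u v -> double c' u v = false.
Proof.
move=> cc' dc; apply/negP => /forallP/(_ c); rewrite cc' /=.
by apply/negP/no_triple.
Qed.

Lemma not_all_colors (h i j : 'I_3) u v : uniq [:: h; i; j] ->
  ~~ [&& x h u v, x i u v & x j u v].
Proof.
move=> hij; apply/negP => /and3P[xh xi xj].
by have := @no_triple h u v; rewrite (doubleE _ _ hij) xh xi xj => /(_ isT).
Qed.

(** In a cherry centred at [v], the row of the leaf [u] is bounded by the palette of [v z] alone, so
    the two leaves can be treated independently. *)
Lemma leaf_bound (h i j : 'I_3) u v z : uniq [:: h; i; j] ->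
  (forall c, lam c <= lam h) -> double i u v ->
  potential u z <=
    if x i v z then
      if x h v z || x j v z then - (lam h + lam i + lam j) else - lam i
    else if x h v z || x j v z then lam i else lam h.
Proof.
move=> hij hmax di; have := no_triple di; move: di.
rewrite (doubleE _ _ (uniq3_swap hij)) => /andP[xh xj] /negPf xi.
have l0 := lam_gt0 h; have l1 := lam_gt0 i; have l2 := lam_gt0 j.
have h1 := hmax i; have h2 := hmax j.
rewrite (potentialE _ _ hij); have := not_all_colors u z hij.
have [] := free6 u v z hij; rewrite xh xi xj /=.
case: (x i v z); case: (x h v z); case: (x j v z);
case: (x h u z); case: (x i u z); case: (x j u z); move=> //= _ _ [] //=; lra.
Qed.

(* The weights are chosen so that every palette of [v z] gives a
   non-positive contribution. *)
Lemma no_minor_cherry (h i j : 'I_3) u v w : uniq [:: h; i; j] ->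
  (forall c, lam c <= lam h) -> double i u v -> double j v w -> False.
Proof.
move=> hij hmax di dj.
have l0 := lam_gt0 h; have l1 := lam_gt0 i; have l2 := lam_gt0 j.
have h1 := hmax i; have h2 := hmax j.
apply: (@combination3 (lam j) (lam i + lam j) (lam i) u v w) => [|||z]; try by lra.
have := leaf_bound z hij hmax di.
rewrite double_sym in dj.
have := leaf_bound z (uniq3_swap (uniq3_rot (uniq3_rot hij))) hmax dj.
rewrite (potentialE v z hij); have := not_all_colors v z hij.
case: (x h v z); case: (x i v z); case: (x j v z); move=> //= _ pw pu.
all: have pw' := ler_wpM2l (ltW l1) pw.
all: have pu' := ler_wpM2l (ltW l2) pu.
all: have e1 : 0 <= lam i * (lam h - lam j) by rewrite mulr_ge0 ?subr_ge0 // ltW.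
all: have e2 : 0 <= lam j * (lam h - lam i) by rewrite mulr_ge0 ?subr_ge0 // ltW.
all: have e3 : 0 < lam i * lam j by rewrite mulr_gt0.
all: have e4 : 0 < lam i * lam i by rewrite mulr_gt0.
all: have e5 : 0 < lam j * lam j by rewrite mulr_gt0.
all: have e6 : 0 < lam h * lam i by rewrite mulr_gt0.
all: have e7 : 0 < lam h * lam j by rewrite mulr_gt0.
all: lra.
Qed.

(** * Main colours, heights and excluded cherries *)

Definition deg (c : 'I_3) (u : V) : R := \sum_w mu w * (double c u w)%:R.
Definition voids (u : V) : R := \sum_w mu w * (empty u w)%:R.

Lemma deg_ge0 c u : 0 <= deg c u.
Proof. by apply: sumr_ge0 => w _; rewrite mulr_ge0 // ltW. Qed.

Lemma deg_gt0_ex c u : 0 < deg c u -> exists w, double c u w.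
Proof.
move=> d0; apply/existsP; apply: contraLR d0; rewrite negb_exists -leNgt => /forallP nd.
rewrite /deg big1 // => w _.
by rewrite (negPf (nd w)) mulr0.
Qed.

Lemma excess_le c u v : excess c u v <= (double c u v)%:R - (empty u v)%:R.
Proof.
have [i [j cij]] := ord3_others c.
rewrite (excessE _ _ cij) (doubleE _ _ cij) (emptyE _ _ cij).
by case: (x c u v); case: (x i u v); case: (x j u v) => /=; lra.
Qed.

(** The stationarity sum is at most the combination of the differences [deg c u - voids u] with
    positive coefficients [lam c], so one difference is positive. *)
Lemma main_color_ex u : exists c, voids u < deg c u.
Proof.
apply/existsP; apply: contraLR (stationary u).
rewrite negb_exists -leNgt => /forallP le_voids.
rewrite (eq_bigr (fun w => \sum_c lam c * (mu w * excess c u w))); last first.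
  by move=> w _; rewrite mulr_sumr; apply: eq_bigr => c _; ring.
rewrite exchange_big /= sumr_le0 // => c _.
rewrite -mulr_sumr pmulr_rle0 // (@le_trans _ _ (deg c u - voids u)) //.
  rewrite -sumrB; apply: ler_sum => w _.
  by rewrite -mulrBr ler_pM2l // excess_le.
by rewrite subr_le0 leNgt; exact: le_voids.
Qed.

(** By [main_color_ex] the search succeeds and the default [ord0] is never returned. *)
Definition main_color (u : V) : 'I_3 := odflt ord0 [pick c | voids u < deg c u].
Definition height (u : V) : R := deg (main_color u) u.

Lemma voids_lt_height u : voids u < height u.
Proof.
rewrite /height /main_color; case: pickP => //= no_c.
by have [c] := main_color_ex u; rewrite no_c.
Qed.

(** A neighbour of [u] in its main colour ends a cherry from [v] through [u], hence is not adjacent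
    to [v]. *)
Lemma height_le_voids c u v : double c u v -> main_color u != c ->
  height u <= voids v.
Proof.
move=> duv cu; apply: ler_sum => w _; rewrite ler_pM2l // ler_nat.
case dw: (double _ u w) => //=; rewrite lt0b.
by apply: cherry_empty _ dw; [rewrite eq_sym; exact: cu|rewrite double_sym].
Qed.

(** [voids v] separates the two heights. If [c] were not the main colour of [v] either, the same
    argument from [v] would reverse the inequality. *)
Lemma climb c u v : double c u v -> main_color u != c ->
  main_color v = c /\ height u < height v.
Proof.
move=> duv cu; have uv := height_le_voids duv cu.
split; last exact: le_lt_trans uv (voids_lt_height v).
apply/eqP/negPn/negP => cv.
have vu := height_le_voids (etrans (double_sym c v u) duv) cv.
have := voids_lt_height u; have := voids_lt_height v.
by move: uv vu; clear; move: (height u) (height v) (voids u) (voids v) => *; lra.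
Qed.

(* Heights strictly increase along one of the two orientations of the cycle. *)
Lemma no_alternating_cycle (c1 c2 c3 c4 : 'I_3) u1 u2 u3 u4 :
  c1 != c2 -> c2 != c3 -> c3 != c4 -> c4 != c1 ->
  double c1 u1 u2 -> double c2 u2 u3 -> double c3 u3 u4 -> double c4 u4 u1 ->
  False.
Proof.
move=> c12 c23 c34 c41 d1 d2 d3 d4.
have [m1|m1] := eqVneq (main_color u1) c1; last first.
  have [m2 h2] := climb d1 m1.
  have [|m3 h3] := climb d2; first by rewrite m2.
  have [|m4 h4] := climb d3; first by rewrite m3.
  have [|_ h1] := climb d4; first by rewrite m4.
  by have := lt_trans (lt_trans h2 h3) (lt_trans h4 h1); rewrite ltxx.
rewrite double_sym in d1; rewrite double_sym in d2.
rewrite double_sym in d3; rewrite double_sym in d4.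
have [|m4 h4] := climb d4; first by rewrite m1 eq_sym.
have [|m3 h3] := climb d3; first by rewrite m4 eq_sym.
have [|m2 h2] := climb d2; first by rewrite m3 eq_sym.
have [|_ h1] := climb d1; first by rewrite m2 eq_sym.
by have := lt_trans (lt_trans h4 h3) (lt_trans h2 h1); rewrite ltxx.
Qed.

(** For [h] maximizing [lam], the cherry in the two colours other than [h] is ruled out by
    [no_minor_cherry]. *)
Lemma no_three_cherries (p q r : 'I_3) u1 v1 w1 u2 v2 w2 u3 v3 w3 :
  uniq [:: p; q; r] ->
  double p u1 v1 -> double q v1 w1 -> double q u2 v2 -> double r v2 w2 ->
  double p u3 v3 -> double r v3 w3 -> False.
Proof.
move=> pqr d1 d1' d2 d2' d3 d3'.
have [h hmax] : exists h, forall c, lam c <= lam h.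
  have [h _ hmax] := @Order.TotalTheory.arg_maxP _ _ _ ord0 xpredT lam isT.
  by exists h => c; exact: hmax.
have := ord3_cover h pqr; rewrite !inE => /or3P[] /eqP eh; subst h.
- exact: no_minor_cherry pqr hmax d2 d2'.
- exact: no_minor_cherry (uniq3_swap pqr) hmax d3 d3'.
- exact: no_minor_cherry (uniq3_rot (uniq3_rot pqr)) hmax d1 d1'.
Qed.

(** * Charging non-adjacent pairs to colours *)

Definition other (c : 'I_3) (u v : V) := [exists c', (c' != c) && double c' u v].
(** The pairs charged to [c]: ordered pairs of ends of a cherry, the colour being read at the second
    end. *)
Definition served (c : 'I_3) (v y : V) := [exists u, double c u y && other c u v].

Lemma served_empty c v y : served c v y -> empty v y.
Proof.
case/existsP => u /andP[duy /existsP[c' /andP[c'c du]]].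
by apply: cherry_empty c'c _ duy; rewrite double_sym.
Qed.

(** Two paths from [v] to [y] with different last colours form an alternating 4-cycle if their first
    colours differ. If these agree, cherries in all three pairs of colours appear. *)
Lemma served_inj c c' v y : served c v y -> served c' v y -> c = c'.
Proof.
case/existsP => u /andP[duy /existsP[d /andP[dc duv]]].
case/existsP => u' /andP[duy' /existsP[d' /andP[dc' duv']]].
apply/eqP/negPn/negP => cc'.
have [eq_d|dd'] := eqVneq d d'; last first.
  rewrite double_sym in duv; rewrite double_sym in duy'.
  by apply: (no_alternating_cycle dc cc' _ _ duv duy duy' duv'); rewrite eq_sym.
subst d'; apply: (@no_three_cherries d c c' v u y u y u' v u' y).
- by rewrite /= !inE negb_or dc dc' cc'.
- by rewrite double_sym.
- exact: duy.
- exact: duy.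
- by rewrite double_sym.
- by rewrite double_sym.
- exact: duy'.
Qed.

Lemma sum_served_le v y : \sum_c (served c v y)%:R <= (empty v y)%:R :> R.
Proof.
have [/existsP[c sc]|] := boolP [exists c, served c v y]; last first.
  rewrite negb_exists => /forallP no.
  by rewrite big1 // => c _; rewrite (negPf (no c)).
rewrite (bigD1 c) //= sc (served_empty sc) big1 ?addr0 // => c' c'c.
by case sc': (served c' v y) => //; rewrite (served_inj sc' sc) eqxx in c'c.
Qed.

(** * Shares of a vertex in the three colours *)

Definition share (c : 'I_3) (u : V) : R :=
  Num.sqrt (deg c u) / \sum_c' Num.sqrt (deg c' u).
Definition other_deg (c : 'I_3) (u : V) : R := \sum_w mu w * (other c u w)%:R.

Lemma share_ge0 c u : 0 <= share c u.
Proof. by rewrite divr_ge0 ?sqrtr_ge0 // sumr_ge0 // => i _; rewrite sqrtr_ge0. Qed.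

Lemma sum_share_le1 u : \sum_c share c u <= 1.
Proof.
rewrite -mulr_suml; set s := \sum_c _.
(* Division by zero gives 0, so a vertex without double edges has no share at all. *)
by have [->|s0] := eqVneq s 0; rewrite ?mul0r // divff.
Qed.

Lemma share_le1 c u : share c u <= 1.
Proof.
apply: le_trans (sum_share_le1 u); rewrite (bigD1 c) //= lerDl.
by apply: sumr_ge0 => i _; exact: share_ge0.
Qed.

Lemma other_degE (c i j : 'I_3) u : uniq [:: c; i; j] ->
  other_deg c u = deg i u + deg j u.
Proof.
move=> cij; have := cij; rewrite /= !inE negb_or => /and3P[/andP[ci cj] ij _].
rewrite -big_split /=; apply: eq_bigr => w _; rewrite -mulrDr -natrD; congr (_ * _%:R).
have -> : other c u w = double i u w || double j u w.
  apply/existsP/orP => [[k /andP[kc dk]]|[di|dj]].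
  - have := ord3_cover k cij; rewrite !inE (negPf kc).
    by move=> /= /orP[] /eqP <-; [left|right].
  - by exists i; rewrite eq_sym ci.
  - by exists j; rewrite eq_sym cj.
by case di: (double i u w) => //=; rewrite (double_other_color ij di).
Qed.

Lemma other_deg_ge0 c u : 0 <= other_deg c u.
Proof. by apply: sumr_ge0 => w _; rewrite mulr_ge0 // ltW. Qed.

(** At most two of the degrees at [u] are positive, as three would give all three kinds of cherries
    centred at [u]. So the roots of the other degrees add up to the root [b] of their sum. With [a]
    the root of a positive [deg c u], both sides equal [a ^+ 2 * b / (a + b)]. *)
Lemma share_defect c u : deg c u * (1 - share c u) <=
  share c u * (Num.sqrt (deg c u) * Num.sqrt (other_deg c u)).
Proof.
have [i [j cij]] := ord3_others c.
have := deg_ge0 c u; rewrite le_eqVlt => /predU1P[<-|dc0].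
  by rewrite sqrtr0 !(mul0r, mulr0).
have zero : deg i u = 0 \/ deg j u = 0.
  have := deg_ge0 i u; rewrite le_eqVlt => /predU1P[<-|di0]; first by left.
  have := deg_ge0 j u; rewrite le_eqVlt => /predU1P[<-|dj0]; first by right.
  have [wc dwc] := deg_gt0_ex dc0; have [wi dwi] := deg_gt0_ex di0.
  have [wj dwj] := deg_gt0_ex dj0; exfalso.
  by apply: (no_three_cherries (u1 := wc) (w1 := wi) (u2 := wi) (w2 := wj)
    (u3 := wc) (w3 := wj) cij _ dwi _ dwj _ dwj); rewrite double_sym.
have sqrt_sum : Num.sqrt (deg i u) + Num.sqrt (deg j u) = Num.sqrt (other_deg c u).
  by rewrite (other_degE _ cij); case: zero => ->; rewrite sqrtr0 ?add0r ?addr0.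
rewrite /share (sum_ord3 _ cij) -addrA sqrt_sum.
set a := Num.sqrt (deg c u); set b := Num.sqrt (other_deg c u).
have a0 : 0 < a by rewrite sqrtr_gt0.
have b0 : 0 <= b by exact: sqrtr_ge0.
have -> : deg c u = a ^+ 2 by rewrite sqr_sqrtr ?ltW.
rewrite le_eqVlt; apply/predU1P; left; field.
by rewrite gt_eqF // ltr_pwDl.
Qed.

(** * Integration against the weights *)

Definition mass (F : V -> R) : R := \sum_u mu u * F u.
Definition pair_mass (F : V -> V -> R) : R := \sum_u \sum_v mu u * mu v * F u v.

Lemma mass_le F G : (forall u, F u <= G u) -> mass F <= mass G.
Proof. by move=> FG; apply: ler_sum => u _; rewrite ler_pM2l. Qed.

Lemma mass_ge0 F : (forall u, 0 <= F u) -> 0 <= mass F.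
Proof. by move=> F0; apply: sumr_ge0 => u _; rewrite mulr_ge0 // ltW. Qed.

Lemma massZ a F : mass (fun u => a * F u) = a * mass F.
Proof. by rewrite mulr_sumr; apply: eq_bigr => u _; ring. Qed.

Lemma massD F G : mass (fun u => F u + G u) = mass F + mass G.
Proof. by rewrite -big_split; apply: eq_bigr => u _; rewrite mulrDr. Qed.

Lemma pair_massE F : pair_mass F = mass (fun u => mass (F u)).
Proof.
apply: eq_bigr => u _; rewrite mulr_sumr; apply: eq_bigr => v _; ring.
Qed.

Lemma pair_mass_swap F : pair_mass F = pair_mass (fun u v => F v u).
Proof.
rewrite /pair_mass exchange_big; apply: eq_bigr => u _; apply: eq_bigr => v _.
by rewrite (mulrC (mu v)).
Qed.

Lemma pair_mass_le F G : (forall u v, F u v <= G u v) -> pair_mass F <= pair_mass G.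
Proof. by move=> FG; rewrite !pair_massE; apply: mass_le => u; exact: mass_le. Qed.

Lemma pair_massD F G : pair_mass (fun u v => F u v + G u v) = pair_mass F + pair_mass G.
Proof.
rewrite /pair_mass -big_split; apply: eq_bigr => u _; rewrite -big_split.
by apply: eq_bigr => v _; rewrite mulrDr.
Qed.

Lemma pair_massZ a F : pair_mass (fun u v => a * F u v) = a * pair_mass F.
Proof.
rewrite /pair_mass mulr_sumr; apply: eq_bigr => u _; rewrite mulr_sumr.
by apply: eq_bigr => v _; ring.
Qed.

Lemma pair_mass_prod F G : pair_mass (fun u v => F u * G v) = mass F * mass G.
Proof.
rewrite pair_massE /mass mulr_suml; apply: eq_bigr => u _.
by rewrite -mulrA; congr (_ * _); rewrite mulr_sumr; apply: eq_bigr => v _; ring.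
Qed.

(** * Density bound for the double edges of one colour *)

Section OneColor.
Variable c : 'I_3.
Let f u := share c u.
Let p u := deg c u.
Let q u := other_deg c u.
Let link v := mass (fun u => (other c u v)%:R * f u).

Lemma link_ge0 v : 0 <= link v.
Proof. by apply: mass_ge0 => u; rewrite mulr_ge0 ?share_ge0. Qed.

(* Two vertices joined to [v] by other double edges span no double edge of
   colour [c], since otherwise one of them would have to be non-adjacent to
   [v]. *)
Lemma link_le u v : other c u v ->
  link v <= mass (fun w => (~~ double c u w)%:R * f w).
Proof.
move=> ouv; apply: mass_le => w; rewrite ler_wpM2r ?share_ge0 // ler_nat.
case owv: (other c w v) => //=; case dw: (double c u w) => //=.
have : empty u v.
  by case/existsP: owv => d /andP[dc dwv]; apply: cherry_empty dw dwv; rewrite eq_sym.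
by case/existsP: ouv => d /andP[_ /double_not_empty/negPf->].
Qed.

Lemma deg_le_served u v : other c u v -> p u <= mass (fun y => (served c v y)%:R).
Proof.
move=> ouv; apply: mass_le => y; rewrite ler_nat.
by case dy: (double c u y) => //=; rewrite lt0b; apply/existsP; exists u; rewrite dy.
Qed.

(** AM-GM for [link v] and [p u * q u / link v]. The factor [f u] covers the case [link v = 0]: [u]
    contributes [mu u * f u] to the link, so [f u = 0]. *)
Lemma amgm_edge u v : other c u v ->
  f u * (2 * (Num.sqrt (p u) * Num.sqrt (q u))) <=
  f u * (link v + p u * q u / link v).
Proof.
move=> ouv; have f0 : 0 <= f u := share_ge0 c u.
have := link_ge0 v; rewrite le_eqVlt => /predU1P[l0|l0].
  suff -> : f u = 0 by rewrite !mul0r.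
  apply/eqP; rewrite eq_le f0 andbT leNgt; apply/negP => fu.
  have : 0 < link v.
    rewrite /link /mass (bigD1 u) //= ouv mul1r; apply: ltr_pwDl.
      exact: mulr_gt0.
    apply: sumr_ge0 => w _; apply: mulr_ge0; first exact: ltW.
    by rewrite mulr_ge0 ?share_ge0.
  by rewrite -l0 ltxx.
apply: ler_wpM2l => //.
have p0 : 0 <= p u := deg_ge0 c u; have q0 : 0 <= q u := other_deg_ge0 c u.
rewrite -[in p u * q u](sqr_sqrtr p0) -[in (_ ^+ 2) * q u](sqr_sqrtr q0) -exprMn.
set s := Num.sqrt (p u) * Num.sqrt (q u).
rewrite -(ler_pM2r l0) (mulrDl (link v)) divfK ?gt_eqF // -subr_ge0.
by rewrite (_ : _ - _ = (link v - s) ^+ 2) ?sqr_ge0 //; ring.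
Qed.

Lemma double_mass_le :
  pair_mass (fun u v => (double c u v)%:R) -
    pair_mass (fun v y => (served c v y)%:R) <= mass f ^+ 2.
Proof.
set n := fun u => mass (fun w => (~~ double c u w)%:R * f w).
(* Pointwise this is [0 <= (1 - f u) * (1 - f v)] on a double edge of colour [c], and an equality
   elsewhere. *)
have step1 : pair_mass (fun u v => (double c u v)%:R) - mass f ^+ 2 <=
    2 * mass (fun u => p u * (1 - f u)) - mass (fun u => f u * n u).
  rewrite expr2 -pair_mass_prod.
  pose loss u v := (1 - f u) * (double c u v)%:R.
  have -> : mass (fun u => p u * (1 - f u)) = pair_mass loss.
    rewrite pair_massE; apply: eq_bigr => u _; congr (_ * _).
    by rewrite massZ mulrC.
  have -> : mass (fun u => f u * n u) =
      pair_mass (fun u v => f u * ((~~ double c u v)%:R * f v)).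
    by rewrite pair_massE; apply: eq_bigr => u _; congr (_ * _); rewrite massZ.
  have -> : 2 * pair_mass loss = pair_mass loss + pair_mass (fun u v => loss v u).
    by rewrite -(pair_mass_swap loss); ring.
  rewrite lerBlDr addrAC lerBrDr -!pair_massD; apply: pair_mass_le => u v.
  rewrite /loss (double_sym c v u).
  have := share_ge0 c u; have := share_ge0 c v.
  have := share_le1 c u; have := share_le1 c v; rewrite -/(f u) -/(f v).
  by case: (double c u v) => /=; move: (f u) (f v) => a b; nra.
have step2 : 2 * mass (fun u => p u * (1 - f u)) <=
    mass (fun u => f u * (2 * (Num.sqrt (p u) * Num.sqrt (q u)))).
  rewrite -massZ; apply: mass_le => u.
  by have := share_defect c u; rewrite -/(f u) -/(p u) -/(q u) => ?; lra.
(* Average [amgm_edge] over the other double edges [u v] at [u], normalizing by [q u]. The first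
   half is at most [n u] by [link_le]. In the second half [q u] cancels; grouped by [v], it is an
   average of [p u] with total weight [link v], bounded by [deg_le_served]. *)
have step3 : mass (fun u => f u * (2 * (Num.sqrt (p u) * Num.sqrt (q u)))) <=
    mass (fun u => f u * n u) + pair_mass (fun v y => (served c v y)%:R).
  pose g u v := (other c u v)%:R * (f u * (link v + p u * q u / link v)) / q u.
  apply: (@le_trans _ _ (pair_mass g)).
    rewrite pair_massE; apply: mass_le => u.
    have := other_deg_ge0 c u; rewrite le_eqVlt => /predU1P[q0|q0].
      rewrite -/(q u) in q0; rewrite -q0 sqrtr0 !mulr0; apply: mass_ge0 => v.
      by rewrite /g -q0 invr0 mulr0.
    rewrite -(ler_pM2r q0).
    have -> : mass (g u) * other_deg c u =
        mass (fun v => (other c u v)%:R * (f u * (link v + p u * q u / link v))).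
      rewrite mulrC -massZ; apply: eq_bigr => v _; congr (_ * _).
      by rewrite /g mulrC divfK // gt_eqF.
    rewrite -(massZ _ (fun v => (other c u v)%:R)); apply: mass_le => v.
    case ouv: (other c u v); rewrite ?mul0r ?mulr0 // mul1r mulr1.
    exact: amgm_edge.
  pose g1 u v := (other c u v)%:R * (f u * link v) / q u.
  pose g2 v u := (other c u v)%:R * (f u * p u) / link v.
  apply: (@le_trans _ _ (pair_mass g1 + pair_mass (fun u v => g2 v u))).
    rewrite -pair_massD; apply: pair_mass_le => u v; rewrite /g /g1 /g2.
    have [q0|q0] := eqVneq (q u) 0.
      rewrite q0 invr0 !mulr0 add0r divr_ge0 ?link_ge0 // mulr_ge0 //.
      by rewrite mulr_ge0 ?share_ge0 ?deg_ge0.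
    rewrite le_eqVlt; apply/predU1P; left.
    have [->|l0] := eqVneq (link v) 0; first by rewrite invr0 !(mulr0, addr0, mul0r).
    by field; rewrite q0 l0.
  apply: lerD.
    rewrite pair_massE; apply: mass_le => u.
    have := other_deg_ge0 c u; rewrite le_eqVlt => /predU1P[q0|q0].
      rewrite [mass (g1 u)]big1 => [|v _]; last by rewrite /g1 /q -q0 invr0 !mulr0.
      apply: mulr_ge0; first exact: share_ge0.
      by apply: mass_ge0 => w; rewrite mulr_ge0 ?share_ge0.
    rewrite -(ler_pM2r q0).
    have -> : mass (g1 u) * other_deg c u =
        mass (fun v => (other c u v)%:R * (f u * link v)).
      rewrite mulrC -massZ; apply: eq_bigr => v _; congr (_ * _).
      by rewrite /g1 mulrC divfK // gt_eqF.
    rewrite /other_deg -massZ; apply: mass_le => v.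
    case ouv: (other c u v); rewrite ?mul0r ?mulr0 // mul1r mulr1.
    by rewrite ler_wpM2l ?share_ge0 // link_le.
  rewrite pair_mass_swap !pair_massE; apply: mass_le => v.
  have := link_ge0 v; rewrite le_eqVlt => /predU1P[l0|l0].
    rewrite [mass (g2 v)]big1 => [|u _]; last by rewrite /g2 -l0 invr0 !mulr0.
    exact: mass_ge0.
  rewrite -(ler_pM2r l0).
  have -> : mass (g2 v) * link v = mass (fun u => (other c u v)%:R * (f u * p u)).
    rewrite mulrC -massZ; apply: eq_bigr => u _; congr (_ * _).
    by rewrite /g2 mulrC divfK // gt_eqF.
  rewrite /link -massZ; apply: mass_le => u.
  case ouv: (other c u v); rewrite ?mul0r ?mulr0 // !mul1r mulrC.
  by rewrite ler_wpM2r ?share_ge0 // deg_le_served.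
by lra.
Qed.

End OneColor.

(** * Contradiction for weighted templates *)

Lemma sum_excess u v :
  \sum_c excess c u v = 2 * (\sum_c (double c u v)%:R - (empty u v)%:R) - 1.
Proof.
have [i [j u1]] := ord3_others ord0.
have u2 := uniq3_swap u1; have u3 := uniq3_rot (uniq3_rot u1).
rewrite !(sum_ord3 _ u1) (excessE _ _ u1) (excessE _ _ u2) (excessE _ _ u3).
rewrite (doubleE _ _ u1) (doubleE _ _ u2) (doubleE _ _ u3) (emptyE _ _ u1).
(* A pair with [k] colours, [k] at most 2, contributes [2 * k - 3] in total. *)
have := not_all_colors u v u1.
by case: (x ord0 u v); case: (x i u v); case: (x j u v) => //= _; ring.
Qed.

(** By convexity the extreme case is [(1 - 2 * tau, tau, tau)] up to order, where the equation for
    [tau] gives equality. *)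
Lemma sum_sqr_le (tau a b d : R) : 9 * tau ^+ 2 - 8 * tau + 1 = 0 ->
  tau <= a -> tau <= b -> tau <= d -> a + b + d <= 1 ->
  2 * (a ^+ 2 + b ^+ 2 + d ^+ 2) <= 1 + 3 * tau ^+ 2.
Proof.
move=> tauE ta tb td abd.
have key (e f g : R) : 0 <= e -> 0 <= f -> 0 <= g -> e + f + g <= 1 - 3 * tau ->
    2 * ((e + tau) ^+ 2 + (f + tau) ^+ 2 + (g + tau) ^+ 2) <= 1 + 3 * tau ^+ 2.
  move=> e0 f0 g0 s1; have s0 : 0 <= e + f + g by rewrite !addr_ge0.
  have ef := mulr_ge0 e0 f0; have eg := mulr_ge0 e0 g0.
  have fg := mulr_ge0 f0 g0; have t0 : 0 <= tau by nra.
  have sq := ler_pM s0 s0 s1 s1; have lin := ler_wpM2l t0 s1; nra.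
have := key (a - tau) (b - tau) (d - tau); rewrite !subrK !subr_ge0; apply=> //.
lra.
Qed.

Lemma weights_not_dense (tau : R) : 0 <= tau -> 9 * tau ^+ 2 - 8 * tau + 1 = 0 ->
  mass (fun=> 1) = 1 -> (forall c, tau ^+ 2 < pair_mass (excess c)) -> False.
Proof.
move=> tau0 tauE mu1 dense.
pose A c := pair_mass (fun u v => (double c u v)%:R).
pose S c := pair_mass (fun v y => (served c v y)%:R).
pose K := pair_mass (fun u v => (empty u v)%:R).
pose r c := mass (share c).
have S0 c : 0 <= S c.
  by rewrite /S pair_massE; apply: mass_ge0 => v; apply: mass_ge0 => y.
have AS c : A c - S c <= r c ^+ 2 := double_mass_le c.
have r0 c : 0 <= r c by apply: mass_ge0 => u; exact: share_ge0.
have EA c : pair_mass (excess c) <= A c - K.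
  rewrite lerBrDr -pair_massD; apply: pair_mass_le => u v.
  by rewrite -lerBrDr excess_le.
have [i [j u1]] := ord3_others ord0.
have SK : S ord0 + S i + S j <= K.
  rewrite -!pair_massD; apply: pair_mass_le => u v.
  by have := sum_served_le u v; rewrite (sum_ord3 _ u1).
have r1 : r ord0 + r i + r j <= 1.
  rewrite -mu1 -!massD; apply: mass_le => u.
  by have := sum_share_le1 u; rewrite (sum_ord3 _ u1).
have total : pair_mass (excess ord0) + pair_mass (excess i) + pair_mass (excess j) =
    2 * (A ord0 + A i + A j - K) - 1.
  suff : pair_mass (excess ord0) + pair_mass (excess i) + pair_mass (excess j)
      + pair_mass (fun _ _ => 1 * 1) + 2 * K = 2 * (A ord0 + A i + A j).
    by rewrite (pair_mass_prod (fun=> 1) (fun=> 1)) mu1 => ?; lra.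
  rewrite -!pair_massD -!pair_massZ -!pair_massD; apply: eq_bigr => u _.
  apply: eq_bigr => v _; congr (_ * _).
  by have := sum_excess u v; rewrite !(sum_ord3 _ u1) => ?; lra.
(* The chain is [tau ^+ 2 < A c - K <= A c - S c <= r c ^+ 2]. *)
have tau_lt c : S c <= K -> tau <= r c.
  move=> Sc; rewrite -(@ler_pXn2r _ 2) ?nnegrE //.
  by have := AS c; have := EA c; have := dense c; lra.
have := @sum_sqr_le tau (r ord0) (r i) (r j) tauE.
have := S0 ord0; have := S0 i; have := S0 j => s1 s2 s3.
have t1 := tau_lt ord0; have t2 := tau_lt i; have t3 := tau_lt j.
have := AS ord0; have := AS i; have := AS j.
have := dense ord0; have := dense i; have := dense j.
move=> d1 d2 d3 a1 a2 a3 /(_ _ _ _ r1).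
have -> : tau <= r ord0 by apply: t1; lra.
have -> : tau <= r i by apply: t2; lra.
have -> : tau <= r j by apply: t3; lra.
(* The total excess is above [3 * tau ^+ 2], yet [total], [SK] and [AS] bound it by twice the sum of
   the [r c ^+ 2], minus 1. *)
by move=> /(_ isT isT isT); lra.
Qed.

End Weights.
End Template.

(** * Optimal weights on the unit cube *)

Section Compactness.
Local Open Scope classical_set_scope.
Local Open Scope ring_scope.

Lemma increase_of_first_order (R : realType) (d1 d2 d3 l1 l2 l3 a1 a2 a3 m : R) :
  0 < d1 -> 0 < d2 -> 0 < d3 -> 0 < m ->
  0 < l1 * (d2 * d3) + l2 * (d1 * d3) + l3 * (d1 * d2) ->
  exists s, [/\ 0 < s <= m, 0 < d1 + s * l1 + s ^+ 2 * a1,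
    0 < d2 + s * l2 + s ^+ 2 * a2, 0 < d3 + s * l3 + s ^+ 2 * a3 &
    d1 * d2 * d3 < (d1 + s * l1 + s ^+ 2 * a1) * (d2 + s * l2 + s ^+ 2 * a2)
                   * (d3 + s * l3 + s ^+ 2 * a3)].
Proof.
move=> d1_gt0 d2_gt0 d3_gt0 m_gt0 slope.
pose x (l a : R) := l%:P + a *: 'X : {poly R}.
pose f (d l a : R) := d%:P + 'X * x l a : {poly R}.
(* [h] is the increment of the product divided by [s]; its value at 0 is the assumed slope. *)
pose h : {poly R} :=
  x l1 a1 * (d2 * d3)%:P + x l2 a2 * (d1 * d3)%:P + x l3 a3 * (d1 * d2)%:P
  + 'X * (x l1 a1 * x l2 a2 * d3%:P + x l1 a1 * x l3 a3 * d2%:P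
          + x l2 a2 * x l3 a3 * d1%:P)
  + 'X * 'X * (x l1 a1 * x l2 a2 * x l3 a3).
have near0 (p : {poly R}) : 0 < p.[0] -> \forall s \near (0 : R)^'+, 0 < p.[s].
  move=> p0; apply: (cvgr_gt p.[0]) => //.
  by apply: cvg_at_right_filter; exact: continuous_horner.
near (0 : R)^'+ => s.
have fE d l a : (f d l a).[s] = d + s * l + s ^+ 2 * a.
  by rewrite /f /x !hornerE /=; ring.
have s_gt0 : 0 < s by near: s; exact: nbhs_right_gt.
exists s; split.
- by rewrite s_gt0 /=; near: s; exact: nbhs_right_le.
- by rewrite -fE; near: s; apply: near0; rewrite /f /x !hornerE /= ?mul0r ?addr0.
- by rewrite -fE; near: s; apply: near0; rewrite /f /x !hornerE /= ?mul0r ?addr0.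
- by rewrite -fE; near: s; apply: near0; rewrite /f /x !hornerE /= ?mul0r ?addr0.
- have h_gt0 : 0 < h.[s].
    near: s; apply: near0; rewrite /h /x !hornerE /=; lra.
  have := mulr_gt0 s_gt0 h_gt0; rewrite -subr_gt0 => lt0.
  rewrite -subr_gt0; move: lt0; rewrite subr0; congr (0 < _).
  by rewrite /h /x !hornerE /=; ring.
Unshelve. all: by end_near.
Qed.

Section Optimum.
Variables (R : realType) (V : finType) (A : 'I_3 -> V -> V -> R).
Hypothesis A_sym : forall c u v, A c u v = A c v u.

Definition quad (c : 'I_3) (mu : V -> R) : R :=
  \sum_u \sum_v mu u * mu v * A c u v.

Lemma quad_continuous c :
  continuous (quad c : prod_topology (fun _ : V => R) -> R).
Proof.
have coord v : continuous (fun mu : prod_topology (fun _ : V => R) => mu v).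
  exact: (@proj_continuous V (fun=> R) v).
apply: continuous_big => [|u _]; first exact: add_continuous.
apply: continuous_big => [|v _ mu]; first exact: add_continuous.
have mulC := continuousM (coord u mu) (coord v mu).
exact (continuousM mulC (@cst_continuous _ _ (A c u v) mu)).
Qed.

Lemma quad_shift c mu v s :
  quad c (fun w => mu w + s * (w == v)%:R) =
  quad c mu + s * (2 * \sum_w mu w * A c v w) + s ^+ 2 * A c v v.
Proof.
have sumv (F : V -> R) : \sum_w (w == v)%:R * F w = F v.
  by rewrite (bigD1 v) //= eqxx mul1r big1 ?addr0 // => w /negPf->; rewrite mul0r.
rewrite /quad.
transitivity (\sum_u (\sum_w mu u * mu w * A c u w
    + s * \sum_w (w == v)%:R * (mu u * A c u w)
    + (u == v)%:R * (s * (\sum_w mu w * A c u w)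
      + s ^+ 2 * \sum_w (w == v)%:R * A c u w))).
  apply: eq_bigr => u _; rewrite mulrDr !mulr_sumr -!big_split /=.
  by apply: eq_bigr => w _; ring.
rewrite !big_split /= sumv -mulr_sumr sumv.
have -> : \sum_u \sum_w (w == v)%:R * (mu u * A c u w) = \sum_w mu w * A c v w.
  by apply: eq_bigr => u _; rewrite sumv A_sym.
ring.
Qed.

(* First-order optimality for the product of the three forms on the unit cube:
   decreasing the weight of a vertex in the support cannot increase it. *)
Lemma stationary_weights : (forall c, 0 < quad c (fun=> 1)) ->
  exists (mu : V -> R) (lam : 'I_3 -> R), [/\ forall v, 0 <= mu v, forall c, 0 < lam c,
    forall c, 0 < quad c mu &
    forall v, 0 < mu v -> 0 <= \sum_c lam c * \sum_w mu w * A c v w].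
Proof.
move=> quad1.
pose W := prod_topology (fun _ : V => R).
(* Twice the positive part of [quad c]: a product of the forms themselves could also be positive
   with two negative factors. *)
pose g c (mu : W) := quad c mu + `|quad c mu|.
pose G (mu : W) := \prod_c g c mu.
have G_cont : continuous G.
  apply: continuous_big => [|c _ mu]; first exact: mul_continuous.
  have fc := @quad_continuous c mu.
  have nc := continuous_comp fc (@norm_continuous _ R _).
  exact (continuousD fc nc).
pose box := [set mu : W | forall v, `[0, 1]%classic (mu v)].
have box_compact : compact box.
  exact (@tychonoff V (fun=> R) (fun=> `[0, 1]%classic)
    (fun=> @segment_compact R 0 1)).
have one_box : box (fun=> 1) by move=> v; rewrite /= in_itv /= ler01 lexx.
have box0 : box !=set0 by exists (fun=> 1).
have [mu mu_box mu_max] := compact_EVT_max box0 box_compact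
  (continuous_subspaceT G_cont).
rewrite inE in mu_box.
have g_pos c nu : 0 < quad c nu -> g c nu = 2 * quad c nu.
  by move=> fc; rewrite /g gtr0_norm //; ring.
have G_gt0 : 0 < G mu.
  apply: lt_le_trans (mu_max (fun=> 1) _); last by rewrite inE.
  by apply: prodr_gt0 => c _; rewrite g_pos // mulr_gt0.
have quad_mu c : 0 < quad c mu.
  rewrite ltNge; apply/negP => fc; move: G_gt0.
  by rewrite /G (bigD1 c) //= /g ler0_norm // subrr mul0r ltxx.
pose d c := quad c mu.
have [i [j u1]] := ord3_others ord0.
(* The multipliers are the partial derivatives of the product with respect to the three forms. *)
exists mu, (fun c => (\prod_c' d c') / d c); split=> //.
- by move=> v; have := mu_box v; rewrite /= in_itv /= => /andP[].
- move=> c; apply: divr_gt0; last exact: quad_mu.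
  by apply: prodr_gt0 => c' _; exact: quad_mu.
move=> v mu_v; rewrite leNgt; apply/negP; pose l c := \sum_w mu w * A c v w.
rewrite (sum_ord3 _ u1) (prod_ord3 _ u1) -/(l _) -/(l i) -/(l j) => slope.
have [|s [/andP[s_gt0 s_le] f1 f2 f3]] := @increase_of_first_order R
    (d ord0) (d i) (d j) (- (2 * l ord0)) (- (2 * l i)) (- (2 * l j))
    (A ord0 v v) (A i v v) (A j v v) (mu v)
    (quad_mu _) (quad_mu _) (quad_mu _) mu_v.
  have d_neq0 c : d c != 0 by rewrite gt_eqF // quad_mu.
  move: slope; rewrite !mulrA.
  have -> : d ord0 * d i * d j / d ord0 = d i * d j by field; exact: d_neq0.
  have -> : d ord0 * d i * d j / d i = d ord0 * d j by field; exact: d_neq0.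
  have -> : d ord0 * d i * d j / d j = d ord0 * d i by field; exact: d_neq0.
  by lra.
pose nu w := mu w + (- s) * (w == v)%:R.
have nuE c : quad c nu = d c + s * - (2 * l c) + s ^+ 2 * A c v v.
  by rewrite quad_shift /d /l; ring.
rewrite -!nuE in f1 f2 f3 *.
have nu_box : nu \in box.
  rewrite inE => w; have := mu_box w; rewrite /nu /= !in_itv /=.
  by case: eqVneq => [->|_] /andP[mu0 mu1]; apply/andP; split=> /=; lra.
move=> increase; have := mu_max nu nu_box.
rewrite leNgt /G !(prod_ord3 _ u1) !g_pos // => /negP; apply.
by move: (quad_mu ord0); rewrite -/(d ord0) -/(d i) -/(d j); lra.
Qed.
End Optimum.

End Compactness.

(** * From dense templates to optimal weights *)

Lemma template_not_dense (R : realType) (V : finType) (x : 'I_3 -> rel V)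
    (tau : R) :
  (forall c, symmetric (x c)) -> rainbow_free x ->
  0 <= tau -> 9 * tau ^+ 2 - 8 * tau + 1 = 0 ->
  (forall c, (1 + tau ^+ 2) * #|V|%:R ^+ 2 <
    \sum_u \sum_v \sum_(i | i != c) (x i u v)%:R) -> False.
Proof.
move=> x_sym x_free tau_ge0 tauE dense.
have tau_gt0 : 0 < tau.
  rewrite lt_neqAle tau_ge0 andbT; apply/eqP => tau0.
  by move: tauE; rewrite -tau0; lra.
pose A c u v : R := excess R x c u v - tau ^+ 2.
have [|c|mu [lam [mu_ge0 lam_gt0 quad_gt0 stat]]] := @stationary_weights R V A.
- by move=> c u v; rewrite /A excess_sym.
- rewrite (_ : quad A c _ = \sum_u \sum_v \sum_(i | i != c) (x i u v)%:R
      - (1 + tau ^+ 2) * #|V|%:R ^+ 2) ?subr_gt0 //.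
  rewrite /quad (eq_bigr (fun u => \sum_v \sum_(i | i != c) (x i u v)%:R
      - (1 + tau ^+ 2) * #|V|%:R)) => [|u _].
    by rewrite big_split /= sumr_const cardT -cardE -mulr_natr; ring.
  rewrite (eq_bigr (fun v => \sum_(i | i != c) (x i u v)%:R - (1 + tau ^+ 2))).
    by rewrite big_split /= sumr_const cardT -cardE -mulr_natr; ring.
  by move=> v _; rewrite /A /excess; ring.
(* [weights_not_dense] takes positive weights of total 1: restrict to the support of [mu] and divide
   by [N]. *)
pose S : {pred V} := [pred v | 0 < mu v].
have sumS (F : V -> R) : \sum_(w : {v in S}) mu (val w) * F (val w) =
    \sum_w mu w * F w.
  rewrite -(big_sub S (fun w => mu w * F w)) [RHS](bigID (mem S)) /=.
  rewrite [X in _ = _ + X]big1 ?addr0 // => w; rewrite inE -leNgt => mu_le0.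
  by rewrite (_ : mu w = 0) ?mul0r //; apply/eqP; rewrite eq_le mu_le0 mu_ge0.
pose N := \sum_w mu w.
have N_ge0 : 0 <= N by apply: sumr_ge0.
have N_gt0 : 0 < N.
  rewrite lt_neqAle N_ge0 andbT eq_sym; apply/eqP => /eqP.
  rewrite psumr_eq0 // => /allP mu0; have := quad_gt0 ord0.
  rewrite /quad big1 ?ltxx // => u _; rewrite big1 // => v _.
  have /implyP/(_ isT)/eqP-> := mu0 u (mem_index_enum u).
  by rewrite !mul0r.
pose x' c (u v : {v in S}) := x c (val u) (val v).
pose mu' (v : {v in S}) := mu (val v) / N.
have massE (F : V -> R) : mass mu' (fun u => F (val u)) = (\sum_w mu w * F w) / N.
  rewrite /mass -sumS mulr_suml; apply: eq_bigr => w _.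
  by rewrite /mu' mulrAC.
apply: (@weights_not_dense R {v in S} x' _ _ mu' lam _ lam_gt0 _ tau tau_ge0 tauE).
- by move=> c u v; exact: x_sym.
- by move=> a b d abd u v w; exact: x_free.
- by move=> v; rewrite divr_gt0 //; exact: (valP v).
- move=> v; rewrite -/(mass _ _) (massE (potential x lam (val v))) divr_gt0 //.
  (* Optimality gives a non-strict inequality for the forms shifted by [tau ^+ 2]; undoing the shift
     adds this positive amount. *)
  apply: lt_le_trans (_ : 0 < tau ^+ 2 * N * \sum_c lam c) _.
    rewrite !mulr_gt0 ?exprn_gt0 // (bigD1 ord0) //= ltr_pwDl //.
    by apply: sumr_ge0 => c _; exact: ltW.
  rewrite -subr_ge0; apply: le_trans (stat _ (valP v)) _.
  rewrite le_eqVlt; apply/predU1P; left.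
  rewrite [X in _ = X - _](eq_bigr
      (fun w => \sum_c lam c * (mu w * excess R x c (val v) w))).
    rewrite exchange_big /= mulr_sumr -sumrB; apply: eq_bigr => c _.
    rewrite -mulr_sumr [_ * N]mulrC -mulrA [_ * lam c]mulrC mulrCA -mulrBr; congr (_ * _).
    rewrite /N mulr_suml -sumrB; apply: eq_bigr => w _.
    by rewrite /A; ring.
  by move=> w _; rewrite mulr_sumr; apply: eq_bigr => c _; rewrite mulrCA.
- rewrite (massE (fun=> 1)) (eq_bigr mu) ?divff ?gt_eqF // => w _.
  by rewrite mulr1.
- move=> c; pose G u := \sum_w mu w * excess R x c u w.
  rewrite pair_massE (_ : mass _ _ = mass mu' (fun u => G (val u) / N)); last first.
    by apply: eq_bigr => u _; congr (_ * _); exact: (massE (excess R x c (val u))).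
  rewrite (massE (fun u => G u / N)) ltr_pdivlMr //.
  have := quad_gt0 c.
  have -> : quad A c mu = \sum_u mu u * G u - tau ^+ 2 * N * N.
    rewrite {2}/N mulr_sumr -sumrB; apply: eq_bigr => u _.
    transitivity (mu u * (G u - tau ^+ 2 * N)); last by ring.
    rewrite /G /N [tau ^+ 2 * _]mulr_sumr -sumrB mulr_sumr.
    by apply: eq_bigr => v _; rewrite /A; ring.
  rewrite subr_gt0 => dense'; rewrite (eq_bigr (fun u => mu u * G u / N)).
    by rewrite -mulr_suml ltr_pdivlMr.
  by move=> u _; rewrite mulrA.
Qed.

(** * Cloning the vertices *)

Definition clones (T : finType) (t : nat) (E : {set T * T}) : rel (T * 'I_t) :=
  fun p q => ((p.2 < q.2)%N && ((p.1, q.1) \in E))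
          || ((q.2 < p.2)%N && ((q.1, p.1) \in E)).

Lemma clones_sym (T : finType) (t : nat) (E : {set T * T}) :
  symmetric (@clones T t E).
Proof. by move=> p q; rewrite /clones orbC. Qed.

Lemma clones_count (R : comPzRingType) (T : finType) (t : nat) (E : {set T * T}) :
  \sum_p \sum_q (@clones T t E p q)%:R = #|E|%:R * (t%:R * (t%:R - 1)) :> R.
Proof.
pose before (p q : T * 'I_t) := (p.2 < q.2)%N && ((p.1, q.1) \in E).
have splitE p q : (@clones T t E p q)%:R = (before p q)%:R + (before q p)%:R :> R.
  rewrite /clones /before.
  by case: (ltngtP p.2 q.2) => /= _; rewrite ?orbF ?addr0 ?add0r.
transitivity (\sum_p \sum_q ((before p q)%:R + (before q p)%:R : R)).
  by apply: eq_bigr => p _; apply: eq_bigr => q _.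
have countE : \sum_u \sum_v ((u, v) \in E)%:R = #|E|%:R :> R.
  rewrite pair_bigA /= -sum1_card natr_sum [RHS]big_mkcond /=.
  by apply: eq_bigr => -[u v] _ /=; case: ((u, v) \in E).
have beforeE : \sum_p \sum_q (before p q)%:R =
    #|E|%:R * \sum_(i < t) \sum_(j < t) (i < j)%:R :> R.
  have pairS (F : T * 'I_t -> R) : \sum_p F p = \sum_u \sum_i F (u, i).
    by rewrite pair_bigA; apply: eq_bigr => -[].
  rewrite -countE pairS mulr_suml; apply: eq_bigr => u _.
  transitivity (\sum_i \sum_v \sum_j (before (u, i) (v, j))%:R : R).
    by apply: eq_bigr => i _; exact: pairS.
  rewrite exchange_big mulr_suml; apply: eq_bigr => v _.
  rewrite mulr_sumr; apply: eq_bigr => i _; rewrite mulr_sumr; apply: eq_bigr => j _.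
  by rewrite /before /= -mulnb natrM mulrC.
under eq_bigr => p _ do rewrite big_split /=.
rewrite big_split /= [X in _ + X]exchange_big /= beforeE -mulrDr; congr (_ * _).
have pairs : \sum_(i < t) \sum_(j < t) (i < j)%:R + \sum_(i < t) \sum_(j < t) (i < j)%:R
    + t%:R = t%:R * t%:R :> R.
  have diag : t%:R = \sum_(i < t) \sum_(j < t) (i == j)%:R :> R.
    transitivity (\sum_(i < t) 1 : R); first by rewrite sumr_const card_ord.
    apply: eq_bigr => i _; rewrite (bigD1 i) //= eqxx big1 ?addr0 // => j.
    by rewrite eq_sym => /negPf->.
  transitivity (\sum_(i < t) \sum_(j < t) 1 : R); last first.
    under eq_bigr do rewrite sumr_const card_ord.
    by rewrite sumr_const card_ord mulr_natr.
  rewrite [X in _ + X + _]exchange_big /= [X in _ + _ + X]diag -!big_split /=.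
  apply: eq_bigr => i _; rewrite -!big_split /=; apply: eq_bigr => j _.
  by rewrite -val_eqE /=; case: (ltngtP i j); rewrite ?addr0 ?add0r.
by rewrite mulrBr mulr1 -pairs addrK.
Qed.

Lemma clones_rainbow_free (T : finType) (G : 'I_3 -> digraph T) (t : nat) :
  ~ rainbow_transitive_triangle G ->
  rainbow_free (fun c => @clones T t (edges (G c))).
Proof.
move=> no_triangle.
have triangle (a b d : 'I_3) (u v w : T) : uniq [:: a; b; d] ->
    (u, v) \in edges (G a) -> (v, w) \in edges (G b) -> (u, w) \in edges (G d) ->
    False.
  rewrite /= !inE negb_or => /and3P[/andP[ab ad] bd _] uv vw uw.
  apply: no_triangle; exists u, v, w, a, b, d; split; split=> //.
  - by apply: contraTneq uv => ->; exact: edges_loopless.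
  - by apply: contraTneq vw => ->; exact: edges_loopless.
  - by apply: contraTneq uw => ->; exact: edges_loopless.
move=> a b d abd [u i] [v j] [w k]; apply/negP; rewrite /clones /=.
have bda := uniq3_rot abd; have dab := uniq3_rot bda.
have bad := uniq3_swap abd; have adb := uniq3_rot bad; have dba := uniq3_rot adb.
(* Of the eight orientations, six order the indices linearly and give a transitive triangle; the two
   cyclic ones are impossible. *)
case/and3P => /orP[] /andP[ij e1] /orP[] /andP[jk e2] /orP[] /andP[ik e3].
- exact: (triangle a b d u v w).
- by have := ltn_trans (ltn_trans ij jk) ik; rewrite ltnn.
- exact: (triangle d b a u w v).
- exact: (triangle d a b w u v).
- exact: (triangle a d b v u w).
- exact: (triangle b d a v w u).
- by have := ltn_trans (ltn_trans jk ij) ik; rewrite ltnn.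
- exact: (triangle b a d w v u).
Qed.

(** * Arithmetic of the threshold *)

Lemma sqrt7_ltE (R : rcfType) (p q k : nat) :
  (p%:R < q%:R + k%:R * Num.sqrt 7 :> R) =
  (p < q)%N || ((p - q) ^ 2 < 7 * k ^ 2)%N.
Proof.
have s7 : 0 <= k%:R * Num.sqrt 7 :> R by rewrite mulr_ge0 ?sqrtr_ge0.
case: (ltnP p q) => [lt_pq|le_qp] /=.
  by rewrite (@lt_le_trans _ _ q%:R) ?ltr_nat // lerDl.
rewrite -ltrBlDl -natrB // -(@ltr_pXn2r _ 2) ?nnegrE //.
by rewrite exprMn sqr_sqrtr ?ler0n // -!natrX -natrM mulnC ltr_nat.
Qed.

(** After clearing denominators, [sqrt7_ltE] reduces the comparison to natural numbers, so its truth
    is the same in every real closed field. *)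
Lemma threshold_transfer (R R' : rcfType) (n m : nat) :
  (104 - 8 * Num.sqrt 7) / 81 * n%:R ^+ 2 + 3 * n%:R < m%:R :> R ->
  (104 - 8 * Num.sqrt 7) / 81 * n%:R ^+ 2 + 3 * n%:R < m%:R :> R'.
Proof.
have thresholdE (F : rcfType) :
    ((104 - 8 * Num.sqrt 7) / 81 * n%:R ^+ 2 + 3 * n%:R < m%:R :> F) =
    ((104 * (n * n) + 243 * n)%:R < (81 * m)%:R + (8 * (n * n))%:R * Num.sqrt 7 :> F).
  by rewrite !natrD !natrM; apply/idP/idP => h; lra.
by rewrite !thresholdE !sqrt7_ltE.
Qed.

(** The weak inequality has slack [(x + 2) * (3 * x * (x + 1) - a * x ^+ 2)], nonnegative as
    [a <= 3]. Taking [x + 2] clones keeps the factor [x + 2 - 1] positive even at [x = 0]. *)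
Lemma clone_threshold (R : realFieldType) (a x e : R) : a <= 3 -> 0 <= x ->
  a * x ^+ 2 + 3 * x < e ->
  a * (x * (x + 2)) ^+ 2 < e * ((x + 2) * (x + 2 - 1)).
Proof.
move=> a3 x0 lt_e; have x1 : 0 < (x + 2) * (x + 2 - 1) by apply: mulr_gt0; lra.
apply: le_lt_trans (_ : (a * x ^+ 2 + 3 * x) * ((x + 2) * (x + 2 - 1)) < _).
  have : 0 <= (x + 2) * (3 * x * (x + 1) - a * x ^+ 2).
    apply: mulr_ge0; first lra.
    have := ler_wpM2r (sqr_ge0 x) a3; lra.
  by rewrite -subr_ge0 => ?; rewrite -subr_ge0; lra.
by rewrite ltr_pM2r.
Qed.

(** * From directed graphs to templates *)

Theorem theorem8 (R : rcfType) (n : nat) (T : finType) (G : 'I_3 -> digraph T)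
    (card_T : #|T| = n)
    (dense : forall i j : 'I_3, (i < j)%N ->
      #|edges (G i)|%:R + #|edges (G j)|%:R
        > (104 - 8 * Num.sqrt 7) / 81 * n%:R ^+ 2 + 3 * n%:R :> R) :
  rainbow_transitive_triangle G.
Proof.
(* The compactness argument runs over the reals, while [R] is any real closed field;
   [threshold_transfer] links the two. *)
pose K := Rdefinitions.R : realType.
apply: contrapT => no_triangle.
pose s : K := Num.sqrt 7; pose tau : K := (4 - s) / 9.
have s2 : s ^+ 2 = 7 by rewrite sqr_sqrtr.
have s0 : 0 <= s by exact: sqrtr_ge0.
have s_le4 : s <= 4 by rewrite -(@ler_pXn2r _ 2) ?nnegrE // s2 -natrX ler_nat.
apply: (@template_not_dense K _ _ tau (fun c => @clones_sym T n.+2 (edges (G c)))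
  (clones_rainbow_free no_triangle)).
- by rewrite /tau divr_ge0 ?subr_ge0.
- by rewrite /tau -[RHS](subrr (s ^+ 2 / 9)) {2}s2; field.
move=> c; have [i [j cij]] := ord3_others c.
have sumE p q : \sum_(k | k != c) (@clones T n.+2 (edges (G k)) p q)%:R =
    (@clones T n.+2 (edges (G i)) p q)%:R + (@clones T n.+2 (edges (G j)) p q)%:R :> K.
  have := excessE K (fun k => @clones T n.+2 (edges (G k))) p q cij.
  by move/(congr1 (+%R^~ 1)); rewrite /excess !subrK.
under eq_bigr => p _ do (under eq_bigr => q _ do rewrite sumE).
under eq_bigr => p _ do rewrite big_split /=.
rewrite big_split /= !clones_count -mulrDl card_prod card_ord card_T.
have denseK : (104 - 8 * s) / 81 * n%:R ^+ 2 + 3 * n%:R <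
    #|edges (G i)|%:R + #|edges (G j)|%:R.
  rewrite -natrD; apply: (@threshold_transfer R); rewrite natrD.
  have /orP[/dense //|/dense] : (i < j)%N || (j < i)%N.
    by rewrite -neq_ltn val_eqE; move: cij; rewrite /= !inE => /and3P[].
  by move=> dense_ji; rewrite [ltRHS]addrC.
(* As [s ^+ 2 = 7], [tau ^+ 2] is [(23 - 8 * s) / 81], whence the constant of the theorem. *)
have tauE : 1 + tau ^+ 2 = (104 - 8 * s) / 81.
  by rewrite /tau expr_div_n; apply/eqP; rewrite -subr_eq0; apply/eqP; lra.
rewrite tauE natrM -[n.+2]addn2 natrD.
by apply: clone_threshold denseK; rewrite ?ler0n // ler_pdivrMr //; lra.
Qed.
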